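(* Let $\mathcal{C}$ be a duoidal category with structure $(\circ,I,\bullet,J,\zeta,\delta,\varpi,\tau)$. Assume that $\mathcal{C}$ has equalizers, that every object of $\mathcal{C}^\bullet=(\mathcal{C},\bullet,J)$ is flat, and that $J$ is a left $\bullet$-cogenerator of $(\mathcal{C},\bullet,J)$. Let $f_1:C_1\to D_1$ and $f_2:C_2\to D_2$ be morphisms of coalgebras in $\mathcal{C}^\bullet$ such that the coinduction functors $f_1^*=-\blacksquare_{D_1}C_1:\mathcal{C}^{D_1}\to\mathcal{C}^{C_1}$ and $f_2^*=-\blacksquare_{D_2}C_2:\mathcal{C}^{D_2}\to\mathcal{C}^{C_2}$ are semiseparable (resp., separable, naturally full). Then $(f_1\circ f_2)^*=-\blacksquare_{D_1\circ D_2}(C_1\circ C_2):\mathcal{C}^{D_1\circ D_2}\to\mathcal{C}^{C_1\circ C_2}$ is also semiseparable (resp., separable, naturally full). (Here $f_1\circ f_2:C_1\circ C_2\to D_1\circ D_2$ is the product of $f_1$ and $f_2$ for the monoidal structure $\circ$.)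
   Context: A duoidal category is a category $\mathcal{C}$ with two monoidal structures $\mathcal{C}^\circ=(\mathcal{C},\circ,I)$ and $\mathcal{C}^\bullet=(\mathcal{C},\bullet,J)$, a natural transformation $\zeta_{A,B,C,D}:(A\bullet B)\circ(C\bullet D)\to(A\circ C)\bullet(B\circ D)$ and morphisms $\delta:I\to I\bullet I$, $\varpi:J\circ J\to J$, $\tau:I\to J$ such that $(J,\varpi,\tau)$ is an algebra in $\mathcal{C}^\circ$, $(I,\delta,\tau)$ is a coalgebra in $\mathcal{C}^\bullet$, and (associativity constraints suppressed, composition written by juxtaposition, $l^\circ,r^\circ,l^\bullet,r^\bullet$ the unit constraints) $\zeta_{A,B,C\circ E,D\circ F}(\mathrm{Id}_{A\bullet B}\circ\zeta_{C,D,E,F})=\zeta_{A\circ C,B\circ D,E,F}(\zeta_{A,B,C,D}\circ\mathrm{Id}_{E\bullet F})$, $(\mathrm{Id}_{A\circ D}\bullet\zeta_{B,C,E,F})\zeta_{A,B\bullet C,D,E\bullet F}=(\zeta_{A,B,D,E}\bullet\mathrm{Id}_{C\circ F})\zeta_{A\bullet B,C,D\bullet E,F}$, $(l^\circ_A\bullet l^\circ_B)\zeta_{I,I,A,B}(\delta\circ\mathrm{Id}_{A\bullet B})=l^\circ_{A\bullet B}$, $(r^\circ_A\bullet r^\circ_B)\zeta_{A,B,I,I}(\mathrm{Id}_{A\bullet B}\circ\delta)=r^\circ_{A\bullet B}$, $l^\bullet_{A\circ B}(\varpi\bullet\mathrm{Id}_{A\circ B})\zeta_{J,A,J,B}=l^\bullet_A\circ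 l^\bullet_B$, $r^\bullet_{A\circ B}(\mathrm{Id}_{A\circ B}\bullet\varpi)\zeta_{A,J,B,J}=r^\bullet_A\circ r^\bullet_B$. For coalgebras $(C,\Delta_C,\varepsilon_C)$, $(D,\Delta_D,\varepsilon_D)$ in $\mathcal{C}^\bullet$, $C\circ D$ is a coalgebra in $\mathcal{C}^\bullet$ with comultiplication $\zeta_{C,C,D,D}(\Delta_C\circ\Delta_D)$ and counit $\varpi(\varepsilon_C\circ\varepsilon_D)$; if $f_1,f_2$ are coalgebra morphisms in $\mathcal{C}^\bullet$, so is $f_1\circ f_2$. For a coalgebra $C$ in $\mathcal{C}^\bullet$, $\mathcal{C}^C$ is the category of right $C$-comodules in $\mathcal{C}^\bullet$. An object $X$ of $\mathcal{C}^\bullet$ is flat if $X\bullet-$ and $-\bullet X$ preserve equalizers. For a coalgebra morphism $\psi:C\to D$ in $\mathcal{C}^\bullet$, $C$ is a left $D$-comodule via $\lambda=(\psi\bullet\mathrm{Id}_C)\Delta_C$; for $(M,\rho)\in\mathcal{C}^D$, $e_M:M\blacksquare_D C\to M\bullet C$ is the equalizer of $\rho\bullet\mathrm{Id}_C$ and $\mathrm{Id}_M\bullet\lambda$. The coinduction functor $\psi^*=-\blacksquare_D C:\mathcal{C}^D\to\mathcal{C}^C$ sends $M$ to $M\blacksquare_D C$ with right $C$-coaction $\rho'$ determined by $(e_M\bullet\mathrm{Id}_C)\rho'=(\mathrm{Id}_M\bullet\Delta_C)e_M$, and $h:M\to N$ to the unique morphism $h\blacksquare_D C$ with $e_N(h\blacksquare_D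 C)=(h\bullet\mathrm{Id}_C)e_M$. $J$ is a left $\bullet$-cogenerator if for any $f,g:Y\to Z\bullet W$ with $(\xi\bullet\mathrm{Id}_W)f=(\xi\bullet\mathrm{Id}_W)g$ for all $\xi:Z\to J$, one has $f=g$. A functor $F:\mathcal{A}\to\mathcal{B}$ induces the natural transformation $\mathcal{F}:\mathrm{Hom}_{\mathcal{A}}(-,-)\to\mathrm{Hom}_{\mathcal{B}}(F-,F-)$, $f\mapsto F(f)$. $F$ is separable (resp. naturally full, semiseparable) if there is a natural transformation $\mathcal{P}:\mathrm{Hom}_{\mathcal{B}}(F-,F-)\to\mathrm{Hom}_{\mathcal{A}}(-,-)$ such that the composite of $\mathcal{F}$ followed by $\mathcal{P}$ is the identity (resp. $\mathcal{P}$ followed by $\mathcal{F}$ is the identity, $\mathcal{F}$ followed by $\mathcal{P}$ followed by $\mathcal{F}$ equals $\mathcal{F}$). *)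

(* Defs.v *)
From mathcomp Require Import ssreflect ssrfun ssrbool.
From mathcomp Require Import boolp.
Set Implicit Arguments.
Unset Strict Implicit.
Unset Printing Implicit Defensive.

Declare Scope cat_scope.
Delimit Scope cat_scope with cat.
Local Open Scope cat_scope.

Reserved Notation "g · f" (at level 40, left associativity).
Reserved Notation "A '∘[' M ] B" (at level 36, M at level 200, B at next level,
  no associativity, format "A  ∘[ M ]  B").
Reserved Notation "f '⊗[' M ] g" (at level 36, M at level 200, g at next level,
  no associativity, format "f  ⊗[ M ]  g").

Record Category := MkCategory {
  ob :> Type;
  hom : ob -> ob -> Type;
  idm : forall A, hom A A;
  comp : forall A B D, hom B D -> hom A B -> hom A D;
  comp_idl : forall A B (f : hom A B), comp (idm B) f = f;
  comp_idr : forall A B (f : hom A B), comp f (idm A) = f;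
  compA : forall A B D E (h : hom D E) (g : hom B D) (f : hom A B),
    comp h (comp g f) = comp (comp h g) f }.

Arguments idm {_} A.
Arguments comp {_ _ _ _} g f.
Notation "g · f" := (comp g f) : cat_scope.

Record Functor (A B : Category) := MkFunctor {
  fob :> A -> B;
  fmap : forall X Y : A, hom X Y -> hom (fob X) (fob Y);
  fmap_id : forall X : A, fmap (idm X) = idm (fob X);
  fmap_comp : forall (X Y Z : A) (g : hom Y Z) (f : hom X Y),
    fmap (g · f) = fmap g · fmap f }.

Arguments fmap {_ _} F {_ _} f : rename.

(* [P] is a natural transformation Hom_B(F-,F-) -> Hom_A(-,-) between functors
   A^op * A -> Set, written out. *)
Definition hom_natural (A B : Category) (F : Functor A B)
    (P : forall X Y : A, hom (F X) (F Y) -> hom X Y) : Prop :=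
  forall (X' X Y Y' : A) (h : hom X' X) (k : hom Y Y') (g : hom (F X) (F Y)),
    P X' Y' (fmap F k · g · fmap F h) = k · P X Y g · h.

Definition separable (A B : Category) (F : Functor A B) : Prop :=
  exists2 P : forall X Y : A, hom (F X) (F Y) -> hom X Y, hom_natural P &
    forall (X Y : A) (f : hom X Y), P X Y (fmap F f) = f.

Definition naturally_full (A B : Category) (F : Functor A B) : Prop :=
  exists2 P : forall X Y : A, hom (F X) (F Y) -> hom X Y, hom_natural P &
    forall (X Y : A) (g : hom (F X) (F Y)), fmap F (P X Y g) = g.

Definition semiseparable (A B : Category) (F : Functor A B) : Prop :=
  exists2 P : forall X Y : A, hom (F X) (F Y) -> hom X Y, hom_natural P &
    forall (X Y : A) (f : hom X Y), fmap F (P X Y (fmap F f)) = fmap F f.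

Definition is_equalizer (A : Category) (E X Y : A)
    (e : hom E X) (f g : hom X Y) : Prop :=
  f · e = g · e /\
  forall (T : A) (h : hom T X), f · h = g · h -> exists! u : hom T E, e · u = h.

Record Equalizer (A : Category) (X Y : A) (f g : hom X Y) := MkEqualizer {
  eq_ob : A;
  eq_mor : hom eq_ob X;
  eq_morP : is_equalizer eq_mor f g }.

(* A choice of an equalizer for each parallel pair; theorems quantify over all
   such choices. *)
Definition has_equalizers (A : Category) : Type :=
  forall (X Y : A) (f g : hom X Y), Equalizer f g.

Definition preserves_equalizers (A B : Category) (F : Functor A B) : Prop :=
  forall (E X Y : A) (e : hom E X) (f g : hom X Y),
    is_equalizer e f g -> is_equalizer (fmap F e) (fmap F f) (fmap F g).

Lemma comp_subst (A : Category) (T X Y Y' Z : A) (t : hom Z T)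
    (g : hom Y Z) (f : hom X Y) (g' : hom Y' Z) (f' : hom X Y') :
  g · f = g' · f' -> t · g · f = t · g' · f'.
Proof. by move=> gf; rewrite -!compA gf. Qed.

Lemma comp_subst1 (A : Category) (T X Y Z : A) (t : hom Z T)
    (g : hom Y Z) (f : hom X Y) (h : hom X Z) :
  g · f = h -> t · g · f = t · h.
Proof. by move=> gf; rewrite -!compA gf. Qed.

Lemma comp_subst3 (A : Category) (S T X Y Y' Z : A) (t : hom Z T)
    (g : hom Y Z) (f : hom X Y) (e : hom S X) (g' : hom Y' Z) (f' : hom S Y') :
  g · f · e = g' · f' -> t · g · f · e = t · g' · f'.
Proof. by move=> gf; rewrite -!compA -gf !compA. Qed.

Section EqualizerLift.
Variables (A : Category) (E X Y : A) (e : hom E X) (f g : hom X Y).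
Hypothesis eP : is_equalizer e f g.

Definition eq_lift (T : A) (h : hom T X) (hP : f · h = g · h) : hom T E :=
  projT1 (cid (eP.2 T h hP)).

Lemma eq_liftE (T : A) (h : hom T X) (hP : f · h = g · h) :
  e · eq_lift hP = h.
Proof. by rewrite /eq_lift; case: cid => u [] /=. Qed.

Lemma eq_mono (T : A) (u v : hom T E) : e · u = e · v -> u = v.
Proof.
move=> euv.
have hP : f · (e · v) = g · (e · v) by rewrite !compA eP.1.
have [w [_ wu]] := eP.2 T (e · v) hP.
by rewrite -(wu u euv) -(wu v erefl).
Qed.

End EqualizerLift.

Record Monoidal (A : Category) := MkMonoidal {
  tob : A -> A -> A;
  tmor : forall X X' Y Y' : A,
    hom X X' -> hom Y Y' -> hom (tob X Y) (tob X' Y');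
  tunit : A;
  tassoc : forall X Y Z : A, hom (tob (tob X Y) Z) (tob X (tob Y Z));
  tassocV : forall X Y Z : A, hom (tob X (tob Y Z)) (tob (tob X Y) Z);
  tunitl : forall X : A, hom (tob tunit X) X;
  tunitlV : forall X : A, hom X (tob tunit X);
  tunitr : forall X : A, hom (tob X tunit) X;
  tunitrV : forall X : A, hom X (tob X tunit);
  tmor_id : forall X Y : A, tmor (idm X) (idm Y) = idm (tob X Y);
  tmor_comp : forall (X X' X'' Y Y' Y'' : A)
    (f' : hom X' X'') (f : hom X X') (g' : hom Y' Y'') (g : hom Y Y'),
    tmor (f' · f) (g' · g) = tmor f' g' · tmor f g;
  tassoc_nat : forall (X X' Y Y' Z Z' : A)
    (f : hom X X') (g : hom Y Y') (h : hom Z Z'),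
    tassoc X' Y' Z' · tmor (tmor f g) h = tmor f (tmor g h) · tassoc X Y Z;
  tassocK : forall X Y Z : A, tassocV X Y Z · tassoc X Y Z = idm _;
  tassocVK : forall X Y Z : A, tassoc X Y Z · tassocV X Y Z = idm _;
  tunitl_nat : forall (X X' : A) (f : hom X X'),
    tunitl X' · tmor (idm tunit) f = f · tunitl X;
  tunitlK : forall X : A, tunitlV X · tunitl X = idm _;
  tunitlVK : forall X : A, tunitl X · tunitlV X = idm _;
  tunitr_nat : forall (X X' : A) (f : hom X X'),
    tunitr X' · tmor f (idm tunit) = f · tunitr X;
  tunitrK : forall X : A, tunitrV X · tunitr X = idm _;
  tunitrVK : forall X : A, tunitr X · tunitrV X = idm _;
  tpentagon : forall W X Y Z : A,
    tassoc W X (tob Y Z) · tassoc (tob W X) Y Z =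
    tmor (idm W) (tassoc X Y Z) · tassoc W (tob X Y) Z
      · tmor (tassoc W X Y) (idm Z);
  ttriangle : forall X Y : A,
    tmor (idm X) (tunitl Y) · tassoc X tunit Y = tmor (tunitr X) (idm Y) }.

Arguments tmor {_} M {_ _ _ _} f g : rename.
Arguments tob {_} M X Y : rename.
Arguments tunit {_} M : rename.
Arguments tassoc {_} M X Y Z : rename.
Arguments tassocV {_} M X Y Z : rename.
Arguments tunitl {_} M X : rename.
Arguments tunitlV {_} M X : rename.
Arguments tunitr {_} M X : rename.
Arguments tunitrV {_} M X : rename.

(* [∘[M]] is the tensor product of objects, [⊗[M]] that of morphisms. *)
Notation "X '∘[' M ] Y" := (tob M X Y) : cat_scope.
Notation "f '⊗[' M ] g" := (tmor M f g) : cat_scope.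

Section MonoidalTheory.
Variables (A : Category) (M : Monoidal A).

Lemma tmor_idl_comp (X Y Y' Y'' : A) (g' : hom Y' Y'') (g : hom Y Y') :
  idm X ⊗[M] (g' · g) = (idm X ⊗[M] g') · (idm X ⊗[M] g).
Proof. by rewrite -tmor_comp comp_idl. Qed.

Lemma tmor_idr_comp (X X' X'' Y : A) (f' : hom X' X'') (f : hom X X') :
  (f' · f) ⊗[M] idm Y = (f' ⊗[M] idm Y) · (f ⊗[M] idm Y).
Proof. by rewrite -tmor_comp comp_idl. Qed.

Definition tensorl (X : A) : Functor A A :=
  @MkFunctor A A (fun Y => X ∘[M] Y) (fun Y Z f => idm X ⊗[M] f)
    (tmor_id M X) (@tmor_idl_comp X).

Definition tensorr (X : A) : Functor A A :=
  @MkFunctor A A (fun Y => Y ∘[M] X) (fun Y Z f => f ⊗[M] idm X)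
    (fun Y => tmor_id M Y X) (fun Y Z W g f => tmor_idr_comp X g f).

Definition flat (X : A) : Prop :=
  preserves_equalizers (tensorl X) /\ preserves_equalizers (tensorr X).

Definition unit_left_cogenerator : Prop :=
  forall (Y Z W : A) (f g : hom Y (Z ∘[M] W)),
    (forall xi : hom Z (tunit M),
       (xi ⊗[M] idm W) · f = (xi ⊗[M] idm W) · g) -> f = g.

Lemma tunitr_inj (X Y : A) (f g : hom X Y) :
  f ⊗[M] idm (tunit M) = g ⊗[M] idm (tunit M) -> f = g.
Proof.
move=> fg.
rewrite -(comp_idr f) -(comp_idr g) -(tunitrVK M) !compA.
by rewrite -!tunitr_nat fg.
Qed.

Lemma tassocV_nat (X X' Y Y' Z Z' : A)
    (f : hom X X') (g : hom Y Y') (h : hom Z Z') :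
  tassocV M X' Y' Z' · (f ⊗[M] (g ⊗[M] h)) =
  ((f ⊗[M] g) ⊗[M] h) · tassocV M X Y Z.
Proof.
rewrite -[LHS]comp_idr -(tassocVK M) !compA -(compA _ _ (tassoc M X Y Z)).
by rewrite -tassoc_nat !compA tassocK comp_idl.
Qed.

Lemma tassoc_inj (T X Y Z : A) (u v : hom T ((X ∘[M] Y) ∘[M] Z)) :
  tassoc M X Y Z · u = tassoc M X Y Z · v -> u = v.
Proof.
move=> uv; rewrite -(comp_idl u) -(comp_idl v) -(tassocK M) -!compA.
by rewrite uv.
Qed.

Lemma tunitr_tensor (X Y : A) :
  (idm X ⊗[M] tunitr M Y) · tassoc M X Y (tunit M) = tunitr M (X ∘[M] Y).
Proof.
apply: tunitr_inj; apply: tassoc_inj.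
rewrite tmor_idr_comp compA tassoc_nat -ttriangle tmor_idl_comp.
rewrite (comp_subst3 _ (esym (tpentagon M X Y _ _))) .
by rewrite -tassoc_nat tmor_id -!compA ttriangle.
Qed.

Lemma tassocV_inj (T X Y Z : A) (u v : hom T (X ∘[M] (Y ∘[M] Z))) :
  tassocV M X Y Z · u = tassocV M X Y Z · v -> u = v.
Proof.
move=> uv; rewrite -(comp_idl u) -(comp_idl v) -(tassocVK M) -!compA.
by rewrite uv.
Qed.

Lemma tpentagonV (W X Y Z : A) :
  (tassocV M W X Y ⊗[M] idm Z) · tassocV M W (X ∘[M] Y) Z
    · (idm W ⊗[M] tassocV M X Y Z) =
  tassocV M (W ∘[M] X) Y Z · tassocV M W X (Y ∘[M] Z).
Proof.
apply: tassoc_inj; apply: tassoc_inj.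
transitivity (idm (W ∘[M] (X ∘[M] (Y ∘[M] Z)))).
  rewrite !compA tpentagon.
  rewrite (comp_subst1 _ (esym (tmor_idr_comp _ _ _))) tassocVK tmor_id comp_idr.
  rewrite (comp_subst1 _ (tassocVK M _ _ _)) comp_idr.
  by rewrite -tmor_idl_comp tassocVK tmor_id.
rewrite (compA _ _ (tassocV M W X _)) tassocVK comp_idl.
by rewrite tassocVK.
Qed.

Lemma tpentagonVl (W X Y Z : A) :
  (tassoc M W X Y ⊗[M] idm Z) · tassocV M (W ∘[M] X) Y Z =
  tassocV M W (X ∘[M] Y) Z · (idm W ⊗[M] tassocV M X Y Z)
    · tassoc M W X (Y ∘[M] Z).
Proof.
rewrite -[RHS]comp_idl -tmor_id -(tassocVK M W X Y) tmor_idr_comp !compA.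
have pV : (tassocV M W X Y ⊗[M] idm Z) · tassocV M W (X ∘[M] Y) Z
    · (idm W ⊗[M] tassocV M X Y Z) · tassoc M W X (Y ∘[M] Z) =
  tassocV M (W ∘[M] X) Y Z.
  by rewrite tpentagonV -compA tassocK comp_idr.
by rewrite -!compA in pV *; rewrite pV.
Qed.

End MonoidalTheory.

Section Coalgebras.
Variables (A : Category) (M : Monoidal A).

Definition is_algebra (X : A) (m : hom (X ∘[M] X) X) (u : hom (tunit M) X) :
    Prop :=
  [/\ m · (m ⊗[M] idm X) = m · (idm X ⊗[M] m) · tassoc M X X X,
      m · (u ⊗[M] idm X) = tunitl M X
    & m · (idm X ⊗[M] u) = tunitr M X].

Definition is_coalgebra (X : A) (d : hom X (X ∘[M] X)) (e : hom X (tunit M)) :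
    Prop :=
  [/\ tassoc M X X X · (d ⊗[M] idm X) · d = (idm X ⊗[M] d) · d,
      tunitl M X · (e ⊗[M] idm X) · d = idm X
    & tunitr M X · (idm X ⊗[M] e) · d = idm X].

Record Coalgebra := MkCoalgebra {
  coalg_ob :> A;
  comul : hom coalg_ob (coalg_ob ∘[M] coalg_ob);
  counit : hom coalg_ob (tunit M);
  coalgP : is_coalgebra comul counit }.

Definition is_coalgebra_mor (C D : Coalgebra) (f : hom C D) : Prop :=
  (f ⊗[M] f) · comul C = comul D · f /\ counit D · f = counit C.

Record CoalgebraMor (C D : Coalgebra) := MkCoalgebraMor {
  coalg_mor :> hom C D;
  coalg_morP : is_coalgebra_mor coalg_mor }.

Definition is_comodule (C : Coalgebra) (X : A) (rho : hom X (X ∘[M] C)) :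
    Prop :=
  tassoc M X C C · (rho ⊗[M] idm (C : A)) · rho = (idm X ⊗[M] comul C) · rho /\
  tunitr M X · (idm X ⊗[M] counit C) · rho = idm X.

Record Comodule (C : Coalgebra) := MkComodule {
  comod_ob :> A;
  coact : hom comod_ob (comod_ob ∘[M] C);
  comodP : is_comodule coact }.

Definition is_comodule_mor (C : Coalgebra) (X Y : Comodule C) (f : hom X Y) :
    Prop :=
  coact Y · f = (f ⊗[M] idm (C : A)) · coact X.

Record ComoduleMor (C : Coalgebra) (X Y : Comodule C) := MkComoduleMor {
  comod_mor :> hom X Y;
  comod_morP : is_comodule_mor comod_mor }.

Lemma comod_mor_inj (C : Coalgebra) (X Y : Comodule C) (f g : ComoduleMor X Y) :
  comod_mor f = comod_mor g -> f = g.
Proof.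
case: f g => [f fP] [g gP] /= fg; rewrite fg in fP *.
by rewrite (Prop_irrelevance fP gP).
Qed.

Lemma comod_id_subproof (C : Coalgebra) (X : Comodule C) :
  is_comodule_mor (idm (X : A)).
Proof. by rewrite /is_comodule_mor tmor_id comp_idl comp_idr. Qed.

Definition comod_id (C : Coalgebra) (X : Comodule C) : ComoduleMor X X :=
  MkComoduleMor (comod_id_subproof X).

Lemma comod_comp_subproof (C : Coalgebra) (X Y Z : Comodule C)
    (g : ComoduleMor Y Z) (f : ComoduleMor X Y) :
  is_comodule_mor (comod_mor g · comod_mor f).
Proof.
rewrite /is_comodule_mor compA (comod_morP g) -compA (comod_morP f).
by rewrite tmor_idr_comp compA.
Qed.

Definition comod_comp (C : Coalgebra) (X Y Z : Comodule C)
    (g : ComoduleMor Y Z) (f : ComoduleMor X Y) : ComoduleMor X Z :=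
  MkComoduleMor (comod_comp_subproof g f).

Lemma comod_comp_idl (C : Coalgebra) (X Y : Comodule C) (f : ComoduleMor X Y) :
  comod_comp (comod_id Y) f = f.
Proof. exact/comod_mor_inj/comp_idl. Qed.

Lemma comod_comp_idr (C : Coalgebra) (X Y : Comodule C) (f : ComoduleMor X Y) :
  comod_comp f (comod_id X) = f.
Proof. exact/comod_mor_inj/comp_idr. Qed.

Lemma comod_compA (C : Coalgebra) (W X Y Z : Comodule C)
    (h : ComoduleMor Y Z) (g : ComoduleMor X Y) (f : ComoduleMor W X) :
  comod_comp h (comod_comp g f) = comod_comp (comod_comp h g) f.
Proof. exact/comod_mor_inj/compA. Qed.

Definition ComodCat (C : Coalgebra) : Category :=
  MkCategory (@comod_comp_idl C) (@comod_comp_idr C) (@comod_compA C).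

End Coalgebras.

Section Coinduction.
Variables (A : Category) (M : Monoidal A) (EQ : has_equalizers A).
Variables (C D : Coalgebra M) (psi : CoalgebraMor C D).
Hypothesis flatC : flat M C.

Definition ind_lcoact : hom C (D ∘[M] C) :=
  (coalg_mor psi ⊗[M] idm (C : A)) · comul C.

Section OnObjects.
Variable X : Comodule D.

(* The cotensor product of X and C over D is the equalizer of [cot_l] and
   [cot_r]; both are taken with values in X • (D • C). *)
Definition cot_l : hom (X ∘[M] C) (X ∘[M] (D ∘[M] C)) :=
  tassoc M X D C · (coact X ⊗[M] idm (C : A)).

Definition cot_r : hom (X ∘[M] C) (X ∘[M] (D ∘[M] C)) :=
  idm (X : A) ⊗[M] ind_lcoact.

Definition cotensor_ob : A := eq_ob (EQ cot_l cot_r).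

Definition cotensor_incl : hom cotensor_ob (X ∘[M] C) :=
  eq_mor (EQ cot_l cot_r).

Lemma cotensor_inclP : is_equalizer cotensor_incl cot_l cot_r.
Proof. exact: eq_morP. Qed.

Lemma cotensor_inclP_tensor :
  is_equalizer (cotensor_incl ⊗[M] idm (C : A))
    (cot_l ⊗[M] idm (C : A)) (cot_r ⊗[M] idm (C : A)).
Proof. exact: flatC.2 cotensor_inclP. Qed.

(* Id • comul, reassociated so as to land in (X • C) • C: the coaction of the
   cotensor product is the one induced by this along the inclusion. *)
Definition free_coact : hom (X ∘[M] C) ((X ∘[M] C) ∘[M] C) :=
  tassocV M X C C · (idm (X : A) ⊗[M] comul C).

Lemma free_coactA :
  (free_coact ⊗[M] idm (C : A)) · free_coact =
  tassocV M (X ∘[M] C) C C · (idm (X ∘[M] C) ⊗[M] comul C) · free_coact.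
Proof.
have [coassoc _ _] := coalgP C.
rewrite /free_coact tmor_idr_comp !compA.
rewrite -(comp_subst _ (tassocV_nat M _ _ _)).
rewrite (comp_subst1 _ (esym (tmor_idl_comp M _ _ _))).
rewrite -(tmor_id M) -(comp_subst _ (tassocV_nat M _ _ _)) -tpentagonV.
rewrite !(comp_subst1 _ (esym (tmor_idl_comp M _ _ _))).
congr (_ · (_ ⊗[M] _)); apply: tassoc_inj.
by rewrite !compA tassocVK comp_idl.
Qed.

Lemma free_coact_counit :
  tunitr M (X ∘[M] C) · (idm (X ∘[M] C) ⊗[M] counit C) · free_coact = idm _.
Proof.
have [_ _ counitr] := coalgP C.
rewrite /free_coact -tunitr_tensor -(tmor_id M) !compA.
rewrite -(comp_subst _ (tassocV_nat M _ _ _)).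
rewrite (comp_subst1 _ (tassocVK M _ _ _)) comp_idr.
by rewrite -!tmor_idl_comp counitr tmor_id.
Qed.

Definition cot_free : hom (X ∘[M] (D ∘[M] C)) ((X ∘[M] (D ∘[M] C)) ∘[M] C) :=
  tassocV M X (D ∘[M] C) C · (idm (X : A) ⊗[M]
     (tassocV M D C C · (idm (D : A) ⊗[M] comul C))).

Lemma cot_l_free : (cot_l ⊗[M] idm (C : A)) · free_coact = cot_free · cot_l.
Proof.
rewrite /cot_free /cot_l /free_coact tmor_idr_comp !compA.
rewrite -(comp_subst _ (tassocV_nat M _ _ _)) tmor_id.
rewrite tmor_idl_comp !compA -(comp_subst _ (tassoc_nat M _ _ _)).
rewrite !(comp_subst1 _ (esym (tmor_comp M _ _ _ _))) tmor_id comp_idl comp_idl.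
by rewrite comp_idr comp_idr tpentagonVl.
Qed.

Lemma cot_r_free : (cot_r ⊗[M] idm (C : A)) · free_coact = cot_free · cot_r.
Proof.
have [coassoc _ _] := coalgP C.
rewrite /cot_free /cot_r /free_coact compA -tassocV_nat -!compA.
rewrite -!tmor_idl_comp; congr (_ · (_ ⊗[M] _)).
rewrite /ind_lcoact; apply: tassoc_inj.
rewrite tmor_idr_comp !compA tassocVK comp_idl tassoc_nat tmor_id.
rewrite (comp_subst3 _ coassoc) -!tmor_comp.
by rewrite !comp_idl !comp_idr.
Qed.

Lemma cotensor_coact_subproof :
  (cot_l ⊗[M] idm (C : A)) · (free_coact · cotensor_incl) =
  (cot_r ⊗[M] idm (C : A)) · (free_coact · cotensor_incl).
Proof.
rewrite (compA _ free_coact) cot_l_free (compA _ free_coact) cot_r_free.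
by rewrite -!(compA cot_free) cotensor_inclP.1.
Qed.

Definition cotensor_coact : hom cotensor_ob (cotensor_ob ∘[M] C) :=
  eq_lift cotensor_inclP_tensor cotensor_coact_subproof.

Lemma cotensor_coactE :
  (cotensor_incl ⊗[M] idm (C : A)) · cotensor_coact =
  free_coact · cotensor_incl.
Proof. exact: eq_liftE. Qed.

Lemma cotensor_comodP : is_comodule cotensor_coact.
Proof.
split; last first.
  apply: (eq_mono cotensor_inclP).
  rewrite comp_idr !compA -tunitr_nat (comp_subst1 _ (esym (tmor_comp M _ _ _ _))).
  rewrite comp_idr comp_idl -{1}(comp_idl cotensor_incl) -(comp_idr (counit C)).
  rewrite tmor_comp -!compA cotensor_coactE (compA _ free_coact).
  by rewrite 2!(compA (tunitr M _)) free_coact_counit comp_idl.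
apply: tassocV_inj.
rewrite -!(compA (tassoc _ _ _ _)) (compA (tassocV _ _ _ _)) tassocK comp_idl.
have eqP2 := flatC.2 _ _ _ _ _ _ cotensor_inclP_tensor.
apply: (eq_mono eqP2) => /=.
rewrite compA -tmor_idr_comp cotensor_coactE tmor_idr_comp -compA.
rewrite cotensor_coactE compA free_coactA.
rewrite [in RHS]compA -tassocV_nat -[in RHS]compA.
rewrite (compA (_ ⊗[M] (_ ⊗[M] _))) -tmor_comp tmor_id comp_idl comp_idr.
rewrite -[comul C in RHS]comp_idr -[cotensor_incl in RHS]comp_idl tmor_comp.
rewrite -[in RHS](compA (_ ⊗[M] _)) cotensor_coactE.
by rewrite (compA _ free_coact) (compA (tassocV _ _ _ _)) [in RHS]compA.
Qed.

Definition cotensor : Comodule C := MkComodule cotensor_comodP.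

End OnObjects.

Section OnMorphisms.
Variables (X Y : Comodule D) (h : ComoduleMor X Y).

Lemma cotensor_map_subproof :
  cot_l Y · ((comod_mor h ⊗[M] idm (C : A)) · cotensor_incl X) =
  cot_r Y · ((comod_mor h ⊗[M] idm (C : A)) · cotensor_incl X).
Proof.
have hl : cot_l Y · (comod_mor h ⊗[M] idm (C : A)) =
    (comod_mor h ⊗[M] idm (D ∘[M] C)) · cot_l X.
  rewrite /cot_l -compA -tmor_idr_comp (comod_morP h) tmor_idr_comp !compA.
  by rewrite tassoc_nat tmor_id.
have hr : cot_r Y · (comod_mor h ⊗[M] idm (C : A)) =
    (comod_mor h ⊗[M] idm (D ∘[M] C)) · cot_r X.
  by rewrite /cot_r -!tmor_comp !comp_idl !comp_idr.
rewrite (compA (cot_l Y)) (compA (cot_r Y)) hl hr.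
by rewrite -!(compA (_ ⊗[M] _)) (cotensor_inclP X).1.
Qed.

Definition cotensor_map : hom (cotensor_ob X) (cotensor_ob Y) :=
  eq_lift (cotensor_inclP Y) cotensor_map_subproof.

Lemma cotensor_mapE :
  cotensor_incl Y · cotensor_map =
  (comod_mor h ⊗[M] idm (C : A)) · cotensor_incl X.
Proof. exact: eq_liftE. Qed.

Lemma cotensor_map_comodP :
  @is_comodule_mor A M C (cotensor X) (cotensor Y) cotensor_map.
Proof.
rewrite /is_comodule_mor /=; apply: (eq_mono (cotensor_inclP_tensor Y)).
rewrite compA cotensor_coactE -compA cotensor_mapE.
rewrite [in RHS]compA -tmor_idr_comp cotensor_mapE tmor_idr_comp.
rewrite -[in RHS]compA cotensor_coactE.
rewrite (compA (free_coact Y)) (compA _ (free_coact X)); congr (_ · _).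
rewrite /free_coact compA -tassocV_nat -!compA -!tmor_comp tmor_id.
by rewrite !comp_idl !comp_idr.
Qed.

Definition cotensor_mor : ComoduleMor (cotensor X) (cotensor Y) :=
  MkComoduleMor cotensor_map_comodP.

End OnMorphisms.

Lemma cotensor_mor_id (X : Comodule D) :
  cotensor_mor (comod_id X) = comod_id (cotensor X).
Proof.
apply/comod_mor_inj/(eq_mono (cotensor_inclP X)) => /=.
by rewrite cotensor_mapE /= tmor_id comp_idl comp_idr.
Qed.

Lemma cotensor_mor_comp (X Y Z : Comodule D)
    (g : ComoduleMor Y Z) (f : ComoduleMor X Y) :
  cotensor_mor (comod_comp g f) = comod_comp (cotensor_mor g) (cotensor_mor f).
Proof.
apply/comod_mor_inj/(eq_mono (cotensor_inclP Z)) => /=.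
rewrite cotensor_mapE /= compA cotensor_mapE -compA cotensor_mapE.
by rewrite tmor_idr_comp compA.
Qed.

Definition coinduction : Functor (ComodCat D) (ComodCat C) :=
  @MkFunctor (ComodCat D) (ComodCat C) cotensor cotensor_mor
    cotensor_mor_id cotensor_mor_comp.

End Coinduction.

(* [dcirc] and [dbul] carry the structures written ∘, I and •, J. The
   associativity constraints, usually left implicit, are written out. *)
Record Duoidal (A : Category) := MkDuoidal {
  dcirc : Monoidal A;
  dbul : Monoidal A;
  zeta : forall X Y Z W : A,
    hom ((X ∘[dbul] Y) ∘[dcirc] (Z ∘[dbul] W))
        ((X ∘[dcirc] Z) ∘[dbul] (Y ∘[dcirc] W));
  ddelta : hom (tunit dcirc) (tunit dcirc ∘[dbul] tunit dcirc);
  dvarpi : hom (tunit dbul ∘[dcirc] tunit dbul) (tunit dbul);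
  dtau : hom (tunit dcirc) (tunit dbul);
  zeta_nat : forall (X X' Y Y' Z Z' W W' : A)
    (f : hom X X') (g : hom Y Y') (h : hom Z Z') (k : hom W W'),
    zeta X' Y' Z' W' · ((f ⊗[dbul] g) ⊗[dcirc] (h ⊗[dbul] k)) =
    ((f ⊗[dcirc] h) ⊗[dbul] (g ⊗[dcirc] k)) · zeta X Y Z W;
  dunit_algebra : @is_algebra A dcirc (tunit dbul) dvarpi dtau;
  dunit_coalgebra : @is_coalgebra A dbul (tunit dcirc) ddelta dtau;
  zeta_assoc_circ : forall X Y Z W E F : A,
    zeta X Y (Z ∘[dcirc] E) (W ∘[dcirc] F)
      · (idm (X ∘[dbul] Y) ⊗[dcirc] zeta Z W E F)
      · tassoc dcirc (X ∘[dbul] Y) (Z ∘[dbul] W) (E ∘[dbul] F) =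
    (tassoc dcirc X Z E ⊗[dbul] tassoc dcirc Y W F)
      · zeta (X ∘[dcirc] Z) (Y ∘[dcirc] W) E F
      · (zeta X Y Z W ⊗[dcirc] idm (E ∘[dbul] F));
  zeta_assoc_bul : forall X Y Z W E F : A,
    (idm (X ∘[dcirc] W) ⊗[dbul] zeta Y Z E F)
      · zeta X (Y ∘[dbul] Z) W (E ∘[dbul] F)
      · (tassoc dbul X Y Z ⊗[dcirc] tassoc dbul W E F) =
    tassoc dbul (X ∘[dcirc] W) (Y ∘[dcirc] E) (Z ∘[dcirc] F)
      · (zeta X Y W E ⊗[dbul] idm (Z ∘[dcirc] F))
      · zeta (X ∘[dbul] Y) Z (W ∘[dbul] E) F;
  zeta_unitl_circ : forall X Y : A,
    (tunitl dcirc X ⊗[dbul] tunitl dcirc Y)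
      · zeta (tunit dcirc) (tunit dcirc) X Y
      · (ddelta ⊗[dcirc] idm (X ∘[dbul] Y)) = tunitl dcirc (X ∘[dbul] Y);
  zeta_unitr_circ : forall X Y : A,
    (tunitr dcirc X ⊗[dbul] tunitr dcirc Y)
      · zeta X Y (tunit dcirc) (tunit dcirc)
      · (idm (X ∘[dbul] Y) ⊗[dcirc] ddelta) = tunitr dcirc (X ∘[dbul] Y);
  zeta_unitl_bul : forall X Y : A,
    tunitl dbul (X ∘[dcirc] Y) · (dvarpi ⊗[dbul] idm (X ∘[dcirc] Y))
      · zeta (tunit dbul) X (tunit dbul) Y =
    tunitl dbul X ⊗[dcirc] tunitl dbul Y;
  zeta_unitr_bul : forall X Y : A,
    tunitr dbul (X ∘[dcirc] Y) · (idm (X ∘[dcirc] Y) ⊗[dbul] dvarpi)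
      · zeta X (tunit dbul) Y (tunit dbul) =
    tunitr dbul X ⊗[dcirc] tunitr dbul Y }.

Arguments zeta {_} d X Y Z W.
Arguments ddelta {_} d.
Arguments dvarpi {_} d.
Arguments dtau {_} d.

Section DuoidalCoalgebras.
Variables (A : Category) (V : Duoidal A).
Local Notation O := (dcirc V).
Local Notation B := (dbul V).

Section OnCoalgebras.
Variables C D : Coalgebra B.

Definition coalg_circ_comul :
    hom (C ∘[O] D) ((C ∘[O] D) ∘[B] (C ∘[O] D)) :=
  zeta V C C D D · (comul C ⊗[O] comul D).

Definition coalg_circ_counit : hom (C ∘[O] D) (tunit B) :=
  dvarpi V · (counit C ⊗[O] counit D).

Lemma coalg_circP : is_coalgebra coalg_circ_comul coalg_circ_counit.
Proof.
have [coassocC counitlC counitrC] := coalgP C.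
have [coassocD counitlD counitrD] := coalgP D.
rewrite /coalg_circ_comul /coalg_circ_counit; split.
- rewrite tmor_idr_comp tmor_idl_comp !compA -{2 4}(tmor_id O).
  rewrite -!(comp_subst _ (zeta_nat V _ _ _ _)) -zeta_assoc_bul.
  rewrite !(comp_subst1 _ (esym (tmor_comp O _ _ _ _))).
  by rewrite !compA coassocC coassocD.
- rewrite tmor_idr_comp !compA -{2}(tmor_id O C D).
  rewrite -(comp_subst _ (zeta_nat V _ _ _ _)) zeta_unitl_bul.
  by rewrite -!tmor_comp counitlC counitlD tmor_id.
- rewrite tmor_idl_comp !compA -{2}(tmor_id O C D).
  rewrite -(comp_subst _ (zeta_nat V _ _ _ _)) zeta_unitr_bul.
  by rewrite -!tmor_comp counitrC counitrD tmor_id.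
Qed.

Definition coalg_circ : Coalgebra B := MkCoalgebra coalg_circP.

End OnCoalgebras.

Lemma coalg_circ_morP (C1 D1 C2 D2 : Coalgebra B)
    (f1 : CoalgebraMor C1 D1) (f2 : CoalgebraMor C2 D2) :
  @is_coalgebra_mor A B (coalg_circ C1 C2) (coalg_circ D1 D2)
    (coalg_mor f1 ⊗[O] coalg_mor f2).
Proof.
have [comul1 counit1] := coalg_morP f1; have [comul2 counit2] := coalg_morP f2.
split; rewrite /= /coalg_circ_comul /coalg_circ_counit.
  by rewrite compA -zeta_nat -!compA -!tmor_comp comul1 comul2.
by rewrite -compA -tmor_comp counit1 counit2.
Qed.

Definition coalg_circ_mor (C1 D1 C2 D2 : Coalgebra B)
    (f1 : CoalgebraMor C1 D1) (f2 : CoalgebraMor C2 D2) :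
    CoalgebraMor (coalg_circ C1 C2) (coalg_circ D1 D2) :=
  MkCoalgebraMor (coalg_circ_morP f1 f2).

End DuoidalCoalgebras.

(* Main.v *)
(* Under the hypotheses on J and on flatness, the coinduction functor along
   psi : C -> D is semiseparable (resp. separable, naturally full) iff there is
   a D-bicolinear chi : D -> C with psi chi psi = psi (resp. psi chi = Id,
   chi psi = Id).  Naturality of zeta makes chi1 ∘ chi2 bicolinear as soon as
   chi1 and chi2 are, and the three equations are stable under ∘.

   From chi, the map (X • chi) rho : X -> X • C factors through X ■_D C as a
   natural map s_X, and P g is s_X followed by g and by the counit.  From P,
   apply P to the unit of corestriction -| coinduction to get
   gamma_X : X -> X ■_D C natural in X, and let chi be gamma_D followed by the
   isomorphism D ■_D C = C. *)
From mathcomp Require Import ssreflect ssrfun ssrbool.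
Require Import Defs.
Set Implicit Arguments.
Unset Strict Implicit.
Unset Printing Implicit Defensive.

Local Open Scope cat_scope.

(** * Coherence of the unit constraints in a monoidal category *)

Section MonoidalCoherence.
Variables (A : Category) (M : Monoidal A).
Local Notation "f ⊗ g" := (f ⊗[M] g) (at level 36, no associativity).

Lemma tmor_split_l (X X' Y Y' : A) (f : hom X X') (g : hom Y Y') :
  f ⊗ g = (f ⊗ idm Y') · (idm X ⊗ g).
Proof. by rewrite -tmor_comp comp_idl comp_idr. Qed.

Lemma tmor_split_r (X X' Y Y' : A) (f : hom X X') (g : hom Y Y') :
  f ⊗ g = (idm X' ⊗ g) · (f ⊗ idm Y).
Proof. by rewrite -tmor_comp comp_idl comp_idr. Qed.

Lemma tunitl_inj (X Y : A) (f g : hom X Y) :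
  idm (tunit M) ⊗ f = idm (tunit M) ⊗ g -> f = g.
Proof.
move=> fg; rewrite -(comp_idr f) -(comp_idr g) -(tunitlVK M) !compA.
by rewrite -!tunitl_nat fg.
Qed.

Lemma tassoc_epi (X Y Z T : A) (u v : hom (X ∘[M] (Y ∘[M] Z)) T) :
  u · tassoc M X Y Z = v · tassoc M X Y Z -> u = v.
Proof.
move=> uv; rewrite -(comp_idr u) -(comp_idr v) -(tassocVK M) !compA.
by rewrite uv.
Qed.

Lemma tunitl_mono (T X : A) (u v : hom T (tunit M ∘[M] X)) :
  tunitl M X · u = tunitl M X · v -> u = v.
Proof.
move=> uv; rewrite -(comp_idl u) -(comp_idl v) -(tunitlK M) -!compA.
by rewrite uv.
Qed.

Lemma tassocr_epi (W X Y Z T : A) 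
    (u v : hom ((W ∘[M] (X ∘[M] Y)) ∘[M] Z) T) :
  u · (tassoc M W X Y ⊗ idm Z) = v · (tassoc M W X Y ⊗ idm Z) -> u = v.
Proof.
move=> uv; rewrite -(comp_idr u) -(comp_idr v) -(tmor_id M) -(tassocVK M).
by rewrite tmor_idr_comp !compA uv.
Qed.

(** Kelly's argument: tensoring with the unit on the left loses nothing, and there the pentagon and
    the triangle reduce the claim to naturality of the associator. *)
Lemma tunitl_tensor (X Y : A) :
  tunitl M (X ∘[M] Y) · tassoc M (tunit M) X Y = tunitl M X ⊗ idm Y.
Proof.
apply: tunitl_inj; apply: tassoc_epi; apply: tassocr_epi.
rewrite tmor_idl_comp (comp_subst3 _ (esym (tpentagon M _ _ _ _))) ttriangle.
rewrite -tassoc_nat -compA -tmor_idr_comp ttriangle.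
by rewrite -(tmor_id M) tassoc_nat.
Qed.

(** After tensoring with J on the right, the sides become l at J • J and J • l, each after the same
    associator. These agree by naturality of l at its own component l at J. *)
Lemma tunitl_tunitr : tunitl M (tunit M) = tunitr M (tunit M).
Proof.
apply: (tunitr_inj (M := M)); rewrite -tunitl_tensor -ttriangle; congr (_ · _).
by apply: tunitl_mono; rewrite tunitl_nat.
Qed.

Lemma ttriangleV (X Y : A) :
  (tunitr M X ⊗ idm Y) · tassocV M X (tunit M) Y = idm X ⊗ tunitl M Y.
Proof. by rewrite -ttriangle -compA tassocVK comp_idr. Qed.

End MonoidalCoherence.

(** * The left D-coaction on C induced by psi *)

Section Coinduction.
Variables (A : Category) (M : Monoidal A).
Local Notation "f ⊗ g" := (f ⊗[M] g) (at level 36, no associativity).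

(** T • C is the cofree comodule on T, so the counit recovers [f] from its colinear extension;
    equations between maps out of C can be tested on these extensions. *)
Lemma comul_counitr (C : Coalgebra M) (T : A) (f : hom C T) :
  tunitr M T · (idm T ⊗ counit C) · ((f ⊗ idm (C : A)) · comul C) = f.
Proof.
have [_ _ counitr] := coalgP C.
rewrite compA (comp_subst1 _ (esym (tmor_split_r M _ _))).
rewrite tmor_split_l compA tunitr_nat -!compA (compA (tunitr M _)) counitr.
by rewrite comp_idr.
Qed.

Lemma comul_cancel (C : Coalgebra M) (T : A) (f g : hom C T) :
  (f ⊗ idm (C : A)) · comul C = (g ⊗ idm (C : A)) · comul C -> f = g.
Proof. by move=> fg; rewrite -(comul_counitr f) fg comul_counitr. Qed.

Definition regular_comodule (C : Coalgebra M) : Comodule C :=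
  @MkComodule A M C C (comul C)
    (let: And3 coassoc _ counitr := coalgP C in conj coassoc counitr).

Variables (EQ : has_equalizers A) (C D : Coalgebra M) (psi : CoalgebraMor C D).
Hypotheses (flatC : flat M C) (flatD : flat M D).
Local Notation lcoact := (ind_lcoact psi).
Local Notation incl := (cotensor_incl EQ psi).
Local Notation F := (coinduction EQ psi flatC).
Local Notation cot := (cotensor EQ psi flatC).

Lemma ind_lcoact_counit :
  tunitl M C · (counit D ⊗ idm (C : A)) · lcoact = idm (C : A).
Proof.
have [_ counitl _] := coalgP C; have [_ psi_counit] := coalg_morP psi.
rewrite /ind_lcoact compA (comp_subst1 _ (esym (tmor_idr_comp M _ _ _))).
by rewrite psi_counit counitl.
Qed.

Lemma ind_lcoact_coassoc :
  tassoc M D D C · (comul D ⊗ idm (C : A)) · lcoact =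
  (idm (D : A) ⊗ lcoact) · lcoact.
Proof.
have [coassoc _ _] := coalgP C; have [psi_comul _] := coalg_morP psi.
rewrite /ind_lcoact compA (comp_subst1 _ (esym (tmor_idr_comp M _ _ _))).
rewrite -psi_comul tmor_idr_comp compA tassoc_nat (comp_subst3 _ coassoc).
by rewrite !compA -!tmor_comp !comp_idl !comp_idr.
Qed.

Lemma ind_lcoact_comul :
  tassoc M D C C · (lcoact ⊗ idm (C : A)) · comul C =
  (idm (D : A) ⊗ comul C) · lcoact.
Proof.
have [coassoc _ _] := coalgP C.
rewrite /ind_lcoact tmor_idr_comp compA tassoc_nat (comp_subst3 _ coassoc).
by rewrite !compA tmor_id -tmor_split_l -tmor_split_r.
Qed.

Lemma ind_lcoact_counitr :
  tunitr M D · (idm (D : A) ⊗ counit C) · lcoact = psi.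
Proof. exact: comul_counitr. Qed.

(** * Corestriction along psi and its adjunction with coinduction *)

Section Corestriction.

Variable N : Comodule C.

Lemma corestrict_comodP :
  is_comodule (C := D) ((idm (N : A) ⊗ coalg_mor psi) · coact N).
Proof.
have [coassoc counitr] := comodP N; have [psi_comul psi_counit] := coalg_morP psi.
split; last first.
  rewrite compA (comp_subst1 _ (esym (tmor_idl_comp M _ _ _))).
  by rewrite psi_counit counitr.
rewrite [in RHS]compA -tmor_idl_comp -psi_comul tmor_idl_comp.
rewrite -[in RHS]compA -coassoc.
rewrite !compA -tassoc_nat -!compA; congr (_ · _); rewrite !compA -!tmor_comp.
by rewrite !comp_idl !comp_idr.
Qed.

Definition corestrict : Comodule D := MkComodule corestrict_comodP.

End Corestriction.

Lemma corestrict_morP (N N' : Comodule C) (g : ComoduleMor N N') :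
  @is_comodule_mor A M D (corestrict N) (corestrict N') g.
Proof.
rewrite /is_comodule_mor /= -compA (comod_morP g) !compA.
by rewrite -tmor_split_l -tmor_split_r.
Qed.

Definition corestrict_mor (N N' : Comodule C) (g : ComoduleMor N N') :
    ComoduleMor (corestrict N) (corestrict N') :=
  MkComoduleMor (corestrict_morP g).

Definition coind_counit_hom (X : Comodule D) : hom (cotensor_ob EQ psi X) X :=
  tunitr M X · (idm (X : A) ⊗ counit C) · incl X.

(** The coaction of X ■_D C is induced by X • Δ_C; the counit of C then kills the first of the two
    copies of C. *)
Lemma coind_counit_coact (X : Comodule D) :
  (coind_counit_hom X ⊗ idm (C : A)) · cotensor_coact EQ psi flatC X = incl X.
Proof.
have [_ counitl _] := coalgP C.
rewrite /coind_counit_hom 2!tmor_idr_comp -compA cotensor_coactE /free_coact.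
rewrite !compA -(comp_subst _ (tassocV_nat M _ _ _)) ttriangleV.
by rewrite -!tmor_idl_comp counitl tmor_id comp_idl.
Qed.

(** Once the coaction of X is moved past the counit of C, the equalizer condition trades it for the
    left D-coaction on C, which the counit of C collapses to psi. *)
Lemma coact_coind_counit (X : Comodule D) :
  coact X · coind_counit_hom X = (idm (X : A) ⊗ coalg_mor psi) · incl X.
Proof.
rewrite /coind_counit_hom !compA -tunitr_nat.
rewrite (comp_subst1 _ (esym (tmor_split_l M _ _))).
rewrite (tmor_split_r M (coact X)) compA -tunitr_tensor.
rewrite -(tmor_id M) (comp_subst _ (tassoc_nat M _ _ _)) -tmor_idl_comp.
rewrite -!compA (compA (tassoc _ _ _ _)) (cotensor_inclP EQ psi X).1.
by rewrite compA -tmor_idl_comp ind_lcoact_counitr.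
Qed.

Lemma coind_counitP (X : Comodule D) :
  @is_comodule_mor A M D (corestrict (cot X)) X (coind_counit_hom X).
Proof.
rewrite /is_comodule_mor coact_coind_counit /= compA.
by rewrite -tmor_split_l [in RHS]tmor_split_r -[in RHS]compA coind_counit_coact.
Qed.

Definition coind_counit (X : Comodule D) : ComoduleMor (corestrict (cot X)) X :=
  MkComoduleMor (coind_counitP X).

Lemma coind_counit_nat (X Y : Comodule D) (h : ComoduleMor X Y) :
  coind_counit_hom Y · cotensor_map EQ psi h = comod_mor h · coind_counit_hom X.
Proof.
rewrite /coind_counit_hom -compA cotensor_mapE !compA -tunitr_nat.
rewrite (comp_subst1 _ (esym (tmor_split_r M _ _))).
by rewrite (comp_subst1 _ (esym (tmor_split_l M _ _))).
Qed.

(** This is coassociativity of N with psi applied to the middle factor. The coaction of N therefore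
    factors through the cotensor product, which gives the unit of the adjunction. *)
Lemma coind_unit_subproof (N : Comodule C) :
  cot_l C (corestrict N) · coact N = cot_r psi (corestrict N) · coact N.
Proof.
have [coassoc _] := comodP N.
rewrite /cot_l /cot_r /= tmor_idr_comp compA tassoc_nat.
by rewrite (comp_subst3 _ coassoc) -tmor_idl_comp.
Qed.

Definition coind_unit_hom (N : Comodule C) :
    hom N (cotensor_ob EQ psi (corestrict N)) :=
  eq_lift (cotensor_inclP EQ psi (corestrict N)) (coind_unit_subproof N).

Lemma coind_unitE (N : Comodule C) :
  incl (corestrict N) · coind_unit_hom N = coact N.
Proof. exact: eq_liftE. Qed.

Lemma coind_unitP (N : Comodule C) :
  @is_comodule_mor A M C N (cot (corestrict N)) (coind_unit_hom N).
Proof.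
have [coassoc _] := comodP N.
rewrite /is_comodule_mor /=.
apply: (eq_mono (cotensor_inclP_tensor EQ psi flatC _)).
rewrite compA cotensor_coactE -compA coind_unitE compA -tmor_idr_comp coind_unitE.
by rewrite /free_coact -compA -coassoc !compA tassocK comp_idl.
Qed.

Definition coind_unit (N : Comodule C) : ComoduleMor N (cot (corestrict N)) :=
  MkComoduleMor (coind_unitP N).

Lemma coind_unit_nat (N N' : Comodule C) (g : ComoduleMor N N') :
  comod_comp (fmap F (corestrict_mor g)) (coind_unit N) =
  comod_comp (coind_unit N') g.
Proof.
apply/comod_mor_inj/(eq_mono (cotensor_inclP EQ psi _)) => /=.
rewrite [in LHS]compA cotensor_mapE [in RHS]compA coind_unitE.
by rewrite -compA coind_unitE (comod_morP g).
Qed.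

Lemma coind_triangle (X : Comodule D) :
  comod_comp (fmap F (coind_counit X)) (coind_unit (cot X)) = comod_id (cot X).
Proof.
apply/comod_mor_inj/(eq_mono (cotensor_inclP EQ psi _)) => /=.
rewrite compA cotensor_mapE -compA (coind_unitE (cot X)).
by rewrite coind_counit_coact comp_idr.
Qed.

(** Left colinearity comes first, then right colinearity, C being a D-bicomodule through psi. *)
Definition is_bicolinear (chi : hom D C) : Prop :=
  (coalg_mor psi ⊗ idm (C : A)) · comul C · chi =
    (idm (D : A) ⊗ chi) · comul D /\
  (idm (C : A) ⊗ coalg_mor psi) · comul C · chi =
    (chi ⊗ idm (D : A)) · comul D.

(** * From a bicolinear map to a natural transformation P *)

Section FromBicolinear.
Variable chi : hom D C.
Hypothesis chi_bicolinear : is_bicolinear chi.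

(** Left colinearity of [chi] and coassociativity of X make the map equalize. *)
Lemma coind_section_subproof (X : Comodule D) :
  cot_l C X · ((idm (X : A) ⊗ chi) · coact X) =
  cot_r psi X · ((idm (X : A) ⊗ chi) · coact X).
Proof.
have [coassoc _] := comodP X; have [chil _] := chi_bicolinear.
rewrite /cot_l /cot_r !compA -tmor_idl_comp [_ · chi]chil tmor_idl_comp.
rewrite -[in RHS]compA -coassoc !compA -tassoc_nat tmor_id.
rewrite (comp_subst1 _ (esym (tmor_split_l M _ _))).
by rewrite (comp_subst1 _ (esym (tmor_split_r M _ _))).
Qed.

Definition coind_section_hom (X : Comodule D) : hom X (cotensor_ob EQ psi X) :=
  eq_lift (cotensor_inclP EQ psi X) (coind_section_subproof X).

Lemma coind_sectionE (X : Comodule D) :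
  incl X · coind_section_hom X = (idm (X : A) ⊗ chi) · coact X.
Proof. exact: eq_liftE. Qed.

(** Right colinearity of [chi] gives colinearity of the section. Flatness of D keeps the inclusion
    monic after - • D, so the equation can be tested there. *)
Lemma coind_sectionP (X : Comodule D) :
  @is_comodule_mor A M D X (corestrict (cot X)) (coind_section_hom X).
Proof.
have [coassoc _] := comodP X; have [_ chir] := chi_bicolinear.
rewrite /is_comodule_mor /=.
apply: (eq_mono (flatD.2 _ _ _ _ _ _ (cotensor_inclP EQ psi X))) => /=.
rewrite [in RHS]compA -tmor_idr_comp coind_sectionE !compA -tmor_split_l.
rewrite tmor_split_r -(compA _ _ (cotensor_coact _ _ _ _)) cotensor_coactE.
rewrite -!compA coind_sectionE /free_coact !compA -(tmor_id M).
rewrite -tassocV_nat !(comp_subst1 _ (esym (tmor_idl_comp M _ _ _))).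
rewrite compA chir tmor_idl_comp compA (comp_subst _ (esym coassoc)) !compA.
rewrite tassocV_nat (comp_subst1 _ (tassocK M _ _ _)) comp_idr.
by rewrite tmor_idr_comp.
Qed.

Definition coind_section (X : Comodule D) : ComoduleMor X (corestrict (cot X)) :=
  MkComoduleMor (coind_sectionP X).

Lemma coind_section_nat (X Y : Comodule D) (h : ComoduleMor X Y) :
  cotensor_map EQ psi h · coind_section_hom X =
  coind_section_hom Y · comod_mor h.
Proof.
apply: (eq_mono (cotensor_inclP EQ psi Y)).
rewrite [in LHS]compA cotensor_mapE [in RHS]compA coind_sectionE.
rewrite -!compA coind_sectionE (comod_morP h) !compA.
by rewrite -tmor_split_l -tmor_split_r.
Qed.

Definition coind_pullback (X Y : Comodule D) (g : ComoduleMor (cot X) (cot Y)) :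
    ComoduleMor X Y :=
  comod_comp (coind_counit Y) (comod_comp (corestrict_mor g) (coind_section X)).

Lemma coind_pullback_natural : hom_natural (F := F) coind_pullback.
Proof.
move=> X' X Y Y' h k g; apply: comod_mor_inj => /=.
rewrite -!(compA _ _ (coind_section_hom X')) coind_section_nat !compA.
by rewrite coind_counit_nat /coind_counit_hom !compA.
Qed.

(** The functional [counit C · chi] on D alone governs this endomorphism of X, which is the identity
    as soon as that functional is [counit D]. *)
Lemma coind_counit_section (X : Comodule D) :
  coind_counit_hom X · coind_section_hom X =
  tunitr M X · (idm (X : A) ⊗ (counit C · chi)) · coact X.
Proof.
rewrite /coind_counit_hom -!compA coind_sectionE (compA _ _ (coact X)).
by rewrite -tmor_idl_comp.
Qed.

Lemma coind_pullback_fmap (X Y : Comodule D) (f : ComoduleMor X Y) :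
  comod_mor (coind_pullback (fmap F f)) =
  comod_mor f · (coind_counit_hom X · coind_section_hom X).
Proof. by rewrite /= compA coind_counit_nat -compA. Qed.

Lemma fmap_coind_pullback (X Y : Comodule D) (g : ComoduleMor (cot X) (cot Y)) :
  incl Y · comod_mor (fmap F (coind_pullback g)) =
  ((coind_counit_hom Y · comod_mor g) ⊗ idm (C : A))
    · ((coind_section_hom X ⊗ idm (C : A)) · incl X).
Proof. by rewrite /= cotensor_mapE /= compA tmor_idr_comp compA. Qed.

(** On the cotensor product the coaction of X can be replaced by the one on C, so [chi] ends up
    composed with psi. *)
Lemma coind_section_incl (X : Comodule D) :
  (incl X ⊗ idm (C : A)) · ((coind_section_hom X ⊗ idm (C : A)) · incl X) =
  tassocV M X C C
    · (idm (X : A) ⊗ (((chi · coalg_mor psi) ⊗ idm (C : A)) · comul C))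
    · incl X.
Proof.
have eqX := (cotensor_inclP EQ psi X).1.
rewrite compA -tmor_idr_comp coind_sectionE tmor_idr_comp.
have -> : coact X ⊗ idm (C : A) = tassocV M X D C · cot_l C X.
  by rewrite /cot_l compA tassocK comp_idl.
rewrite -compA -[in LHS](compA (tassocV _ _ _ _)) eqX.
rewrite /cot_r !compA -tassocV_nat -(compA (tassocV _ _ _ _)) -tmor_idl_comp.
by rewrite /ind_lcoact compA -tmor_idr_comp.
Qed.

Lemma separable_of_bicolinear :
  coalg_mor psi · chi = idm (D : A) -> separable F.
Proof.
move=> psichi; exists coind_pullback; first exact: coind_pullback_natural.
move=> X Y f; apply: comod_mor_inj; rewrite coind_pullback_fmap.
have [_ psi_counit] := coalg_morP psi; have [_ counitr] := comodP X.
rewrite coind_counit_section -psi_counit -(compA (counit D)) psichi comp_idr.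
by rewrite counitr comp_idr.
Qed.

(** When chi psi = Id, the section tensored with C restricts to the coaction of X ■_D C. Colinearity
    of g carries it over to Y, where the counit undoes it. *)
Lemma naturally_full_of_bicolinear :
  chi · coalg_mor psi = idm (C : A) -> naturally_full F.
Proof.
move=> chipsi; exists coind_pullback; first exact: coind_pullback_natural.
move=> X Y g; apply/comod_mor_inj/(eq_mono (cotensor_inclP EQ psi Y)).
rewrite fmap_coind_pullback.
have -> : (coind_section_hom X ⊗ idm (C : A)) · incl X = coact (cot X).
  apply: (eq_mono (cotensor_inclP_tensor EQ psi flatC _)) => /=.
  by rewrite coind_section_incl chipsi tmor_id comp_idl cotensor_coactE.
rewrite tmor_idr_comp -compA -(comod_morP g) /= compA.
by rewrite coind_counit_coact.
Qed.

Lemma semiseparable_of_bicolinear :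
  coalg_mor psi · chi · coalg_mor psi = psi -> semiseparable F.
Proof.
move=> psichipsi; exists coind_pullback; first exact: coind_pullback_natural.
move=> X Y f; apply/comod_mor_inj/(eq_mono (cotensor_inclP EQ psi Y)).
have [_ psi_counit] := coalg_morP psi; have [_ counitl _] := coalgP C.
have eqX := (cotensor_inclP EQ psi X).1.
rewrite /= !cotensor_mapE [comod_mor (coind_pullback _)]coind_pullback_fmap.
rewrite tmor_idr_comp -compA; congr (_ · _).
(* The triangle shifts the functional [counit C · chi] to the middle factor, where the equalizer
   condition feeds it psi. Since psi chi psi = psi and psi preserves counits, it becomes
   [counit C]. *)
rewrite coind_counit_section 2!tmor_idr_comp -ttriangle -!compA.
rewrite (compA (tassoc _ _ _ _)) tassoc_nat -compA (compA (tassoc _ _ _ _)) eqX.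
rewrite /cot_r !compA -!tmor_idl_comp /ind_lcoact compA -!(compA (tunitl _ _)).
rewrite -tmor_idr_comp -psi_counit -!(compA (counit D)).
rewrite psichipsi psi_counit compA counitl tmor_id.
by rewrite comp_idl.
Qed.

End FromBicolinear.

(** * The isomorphism between D ■_D C and C *)

Lemma ind_lcoact_mono (T : A) (u v : hom T (C ∘[M] C)) :
  (lcoact ⊗ idm (C : A)) · u = (lcoact ⊗ idm (C : A)) · v -> u = v.
Proof.
have retr : ((tunitl M C · (counit D ⊗ idm (C : A))) ⊗ idm (C : A))
    · (lcoact ⊗ idm (C : A)) = idm _.
  by rewrite -tmor_idr_comp ind_lcoact_counit tmor_id.
by move=> uv; rewrite -(comp_idl u) -(comp_idl v) -retr -!compA uv.
Qed.

Local Notation regD := (regular_comodule D).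

Definition cotensor_proj : hom (cotensor_ob EQ psi regD) C :=
  tunitl M C · (counit D ⊗ idm (C : A)) · incl regD.

(** Apply the counit of D to the first factor of the equalizer equation: one side gives the
    left-hand composite, the other the inclusion, by the counit law of D. *)
Lemma ind_lcoact_proj : lcoact · cotensor_proj = incl regD.
Proof.
have [_ counitl _] := coalgP D.
rewrite /cotensor_proj !compA -tunitl_nat.
rewrite (comp_subst1 _ (esym (tmor_split_r M _ _))) tmor_split_l -!compA.
rewrite -(cotensor_inclP EQ psi regD).1 /cot_l /= !compA -(tmor_id M).
rewrite -(comp_subst _ (tassoc_nat M _ _ _)) tunitl_tensor.
by rewrite -!tmor_idr_comp counitl tmor_id comp_idl.
Qed.

Lemma cotensor_proj_coact :
  (cotensor_proj ⊗ idm (C : A)) · cotensor_coact EQ psi flatC regD =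
  comul C · cotensor_proj.
Proof.
apply: ind_lcoact_mono; rewrite compA -tmor_idr_comp ind_lcoact_proj.
rewrite cotensor_coactE /free_coact -ind_lcoact_proj.
rewrite [in LHS](compA _ lcoact) -(compA (tassocV _ _ _ _)) -ind_lcoact_comul.
by rewrite 2!(compA (tassocV _ _ _ _)) tassocK comp_idl [in RHS]compA.
Qed.

Lemma coind_counit_proj : coind_counit_hom regD = coalg_mor psi · cotensor_proj.
Proof.
by rewrite /coind_counit_hom -ind_lcoact_proj compA ind_lcoact_counitr.
Qed.

(** [s] is the factorization of the left coaction through the equalizer, available by its
    coassociativity. *)
Lemma cotensor_proj_surj :
  exists2 s : hom C (cotensor_ob EQ psi regD), incl regD · s = lcoact &
    cotensor_proj · s = idm (C : A).
Proof.
have lP : cot_l C regD · lcoact = cot_r psi regD · lcoact.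
  exact: ind_lcoact_coassoc.
exists (eq_lift (cotensor_inclP EQ psi regD) lP); first exact: eq_liftE.
by rewrite /cotensor_proj -compA eq_liftE ind_lcoact_counit.
Qed.

(** * From a natural transformation P to a bicolinear map *)

Section ToBicolinear.
Variable P : forall X Y : Comodule D,
  ComoduleMor (cot X) (cot Y) -> ComoduleMor X Y.
Hypothesis P_natural : hom_natural (F := F) P.

Definition unit_preimage (X : Comodule D) : ComoduleMor X (corestrict (cot X)) :=
  P (coind_unit (cot X)).

(** Naturality of P moves [h] inside P on both sides, in the target and in the source; naturality of
    the adjunction unit identifies the results. *)
Lemma unit_preimage_natural (X Y : Comodule D) (h : ComoduleMor X Y) :
  comod_comp (corestrict_mor (cotensor_mor EQ psi flatC h)) (unit_preimage X) =
  comod_comp (unit_preimage Y) h.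
Proof.
have := P_natural (comod_id X) (corestrict_mor (cotensor_mor EQ psi flatC h))
  (coind_unit (cot X)).
have := P_natural h (comod_id _) (coind_unit (cot Y)).
rewrite /= !cotensor_mor_id !comod_comp_idl !comod_comp_idr => <- <-.
by rewrite -coind_unit_nat.
Qed.

(** Naturality of P in its target brings the counit inside P, where the triangle identity
    applies. *)
Lemma coind_counit_gamma (X : Comodule D) :
  comod_comp (coind_counit X) (unit_preimage X) = P (comod_id (cot X)).
Proof.
have := P_natural (comod_id X) (coind_counit X) (coind_unit (cot X)).
rewrite /= cotensor_mor_id !comod_comp_idr => <-.
by rewrite [X in P X]coind_triangle.
Qed.

Definition induced_chi : hom D C :=
  cotensor_proj · comod_mor (unit_preimage regD).

(** The preimage at D is D-colinear and the projection onto C is C-colinear. *)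
Lemma induced_chi_right :
  (idm (C : A) ⊗ coalg_mor psi) · comul C · induced_chi =
  (induced_chi ⊗ idm (D : A)) · comul D.
Proof.
rewrite /induced_chi -(compA _ (comul C)) (compA (comul C)) -cotensor_proj_coact.
have /= gammaP := comod_morP (unit_preimage regD).
rewrite tmor_idr_comp -[in RHS]compA -[_ · comul D]gammaP !compA.
by rewrite -tmor_split_l -tmor_split_r.
Qed.

(** In Sweedler notation, d maps to xi(d1) d2. Acting on the left leg, it commutes with the right
    coaction. *)
Definition convolve (xi : hom D (tunit M)) : hom D D :=
  tunitl M D · (xi ⊗ idm (D : A)) · comul D.

Lemma convolveP (xi : hom D (tunit M)) :
  @is_comodule_mor A M D regD regD (convolve xi).
Proof.
have [coassoc _ _] := coalgP D.
rewrite /is_comodule_mor /= /convolve !compA -tunitl_nat.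
rewrite (comp_subst1 _ (esym (tmor_split_r M _ _))) tmor_split_l -!compA -coassoc.
rewrite !tmor_idr_comp -tunitl_tensor !compA -(tmor_id M).
by rewrite -(comp_subst _ (tassoc_nat M _ _ _)).
Qed.

Lemma counit_convolve (xi : hom D (tunit M)) : counit D · convolve xi = xi.
Proof.
rewrite /convolve !compA -tunitl_nat tunitl_tunitr.
rewrite (comp_subst1 _ (esym (tmor_split_r M _ _))) (tmor_split_r M xi).
rewrite [in LHS]compA -[in LHS]compA; exact: comul_counitr.
Qed.

(* For every xi : D -> J, naturality of the preimages at the comodule
   endomorphism [convolve xi] of D gives the equation after composing with
   xi • C; the cogenerator hypothesis removes xi. *)
Lemma induced_chi_left : unit_left_cogenerator M ->
  (coalg_mor psi ⊗ idm (C : A)) · comul C · induced_chi =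
  (idm (D : A) ⊗ induced_chi) · comul D.
Proof.
move=> cogen; apply: cogen => xi; apply: tunitl_mono.
pose t : ComoduleMor regD regD := MkComoduleMor (convolveP xi).
have gamma_t := congr1 (@comod_mor _ _ _ _ _) (unit_preimage_natural t).
rewrite /= in gamma_t.
(* The right side reaches this value by naturality of l, the left side by [gamma_t]. *)
transitivity (induced_chi · convolve xi); last first.
  rewrite /convolve !compA -tunitl_nat.
  rewrite (comp_subst1 _ (esym (tmor_split_r M _ _))) (tmor_split_l M xi).
  by rewrite !compA.
rewrite -[_ · comul C]/lcoact /induced_chi -[in RHS]compA -gamma_t.
rewrite (compA lcoact) ind_lcoact_proj /cotensor_proj !compA.
rewrite -(compA _ (incl regD) (cotensor_map _ _ _)) cotensor_mapE /=.
rewrite !compA (comp_subst1 _ (esym (tmor_idr_comp M _ _ _))).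
by rewrite counit_convolve.
Qed.

Lemma induced_chi_bicolinear :
  unit_left_cogenerator M -> is_bicolinear induced_chi.
Proof.
by move=> cogen; split; [exact: induced_chi_left | exact: induced_chi_right].
Qed.

(** The counit at D is psi after the projection onto C. This turns conditions on P into equations on
    psi chi. *)
Lemma psi_induced_chi :
  coalg_mor psi · induced_chi = comod_mor (P (comod_id (cot regD))).
Proof. by rewrite -coind_counit_gamma /= coind_counit_proj compA. Qed.

Lemma induced_chi_section :
  (forall (X Y : Comodule D) (f : ComoduleMor X Y), P (fmap F f) = f) ->
  coalg_mor psi · induced_chi = idm (D : A).
Proof.
move=> PF.
by rewrite psi_induced_chi -cotensor_mor_id [P _](PF _ _ (comod_id _)).
Qed.

Lemma induced_chi_retraction :
  (forall (X Y : Comodule D) (g : ComoduleMor (cot X) (cot Y)),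
     fmap F (P g) = g) ->
  induced_chi · coalg_mor psi = idm (C : A).
Proof.
move=> FP; have [s incl_s proj_s] := cotensor_proj_surj.
have := congr1 (fun g : ComoduleMor (cot regD) (cot (corestrict (cot regD))) =>
    incl (corestrict (cot regD)) · comod_mor g) (FP _ _ (coind_unit (cot regD))).
rewrite /= cotensor_mapE (coind_unitE (cot regD)) /= -/(unit_preimage regD).
(* [gammaE]: the preimage at D, tensored with C and restricted to D ■_D C, is the coaction of D ■_D
   C. Transporting this along the projection and [s] shows that chi psi and Id have the same
   colinear extension. *)
move=> gammaE.
apply: comul_cancel; rewrite tmor_id comp_idl tmor_idr_comp -compA.
rewrite -/lcoact -incl_s /induced_chi tmor_idr_comp -compA.
rewrite (compA _ (incl regD)) gammaE compA cotensor_proj_coact -compA proj_s.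
by rewrite comp_idr.
Qed.

Lemma induced_chi_semi :
  (forall (X Y : Comodule D) (f : ComoduleMor X Y),
     fmap F (P (fmap F f)) = fmap F f) ->
  coalg_mor psi · induced_chi · coalg_mor psi = psi.
Proof.
move=> FPF; have [s incl_s _] := cotensor_proj_surj.
have := congr1
  (fun g : ComoduleMor (cot regD) (cot regD) => incl regD · comod_mor g)
  (FPF _ _ (comod_id regD)).
rewrite /= cotensor_mor_id !cotensor_mapE -psi_induced_chi /= tmor_id.
(* [kappaE]: psi chi tensored with C fixes the inclusion, hence also the left coaction, which
   factors through it by [s]. *)
rewrite comp_idl => kappaE.
apply: comul_cancel; rewrite tmor_idr_comp -compA -/lcoact -incl_s.
by rewrite compA kappaE.
Qed.

End ToBicolinear.

(** * Characterizations of the three properties by bicolinear maps *)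

Lemma separable_coinductionP : unit_left_cogenerator M ->
  separable F <->
  exists2 chi : hom D C, is_bicolinear chi & coalg_mor psi · chi = idm (D : A).
Proof.
move=> cogen; split=> [[P Pnat PF]|[chi]]; last exact: separable_of_bicolinear.
exists (induced_chi P); first exact: induced_chi_bicolinear.
exact: induced_chi_section.
Qed.

Lemma naturally_full_coinductionP : unit_left_cogenerator M ->
  naturally_full F <->
  exists2 chi : hom D C, is_bicolinear chi & chi · coalg_mor psi = idm (C : A).
Proof.
move=> cogen; split=> [[P Pnat FP]|[chi]]; last first.
  exact: naturally_full_of_bicolinear.
exists (induced_chi P); first exact: induced_chi_bicolinear.
exact: induced_chi_retraction.
Qed.

Lemma semiseparable_coinductionP : unit_left_cogenerator M ->
  semiseparable F <->
  exists2 chi : hom D C, is_bicolinear chi &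
    coalg_mor psi · chi · coalg_mor psi = psi.
Proof.
move=> cogen; split=> [[P Pnat FPF]|[chi]]; last first.
  exact: semiseparable_of_bicolinear.
exists (induced_chi P); first exact: induced_chi_bicolinear.
exact: induced_chi_semi.
Qed.

End Coinduction.

(** * Stability under the product ∘ *)

Lemma bicolinear_circ (A : Category) (V : Duoidal A)
    (C1 D1 C2 D2 : Coalgebra (dbul V))
    (f1 : CoalgebraMor C1 D1) (f2 : CoalgebraMor C2 D2)
    (chi1 : hom D1 C1) (chi2 : hom D2 C2) :
  is_bicolinear f1 chi1 -> is_bicolinear f2 chi2 ->
  is_bicolinear (coalg_circ_mor f1 f2) (chi1 ⊗[dcirc V] chi2).
Proof.
(* Identities of ∘-products are split into ∘-products of identities, the form to which naturality of
   zeta applies. *)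
move=> [l1 r1] [l2 r2]; split; rewrite /= /coalg_circ_comul -!(tmor_id (dcirc V)).
- by rewrite !compA -!zeta_nat -!compA -!tmor_comp !compA l1 l2.
- by rewrite !compA -!zeta_nat -!compA -!tmor_comp !compA r1 r2.
Qed.

Theorem proposition5p9 (A : Category) (V : Duoidal A)
    (EQ : has_equalizers A)
    (hflat : forall X : A, flat (dbul V) X)
    (hJ : unit_left_cogenerator (dbul V))
    (C1 D1 C2 D2 : Coalgebra (dbul V))
    (f1 : CoalgebraMor C1 D1) (f2 : CoalgebraMor C2 D2) :
  (semiseparable (coinduction EQ f1 (hflat C1)) ->
   semiseparable (coinduction EQ f2 (hflat C2)) ->
   semiseparable
     (coinduction EQ (coalg_circ_mor f1 f2) (hflat (coalg_circ C1 C2)))) /\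
  (separable (coinduction EQ f1 (hflat C1)) ->
   separable (coinduction EQ f2 (hflat C2)) ->
   separable
     (coinduction EQ (coalg_circ_mor f1 f2) (hflat (coalg_circ C1 C2)))) /\
  (naturally_full (coinduction EQ f1 (hflat C1)) ->
   naturally_full (coinduction EQ f2 (hflat C2)) ->
   naturally_full
     (coinduction EQ (coalg_circ_mor f1 f2) (hflat (coalg_circ C1 C2)))).
Proof.
split; [|split].
- move=> /(semiseparable_coinductionP _ _ _ (hflat D1) hJ)[chi1 bic1 chi1P].
  move=> /(semiseparable_coinductionP _ _ _ (hflat D2) hJ)[chi2 bic2 chi2P].
  apply/(semiseparable_coinductionP _ _ _ (hflat _) hJ).
  exists (chi1 ⊗[dcirc V] chi2); first exact: bicolinear_circ.
  by rewrite /= -!tmor_comp chi1P chi2P.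
- move=> /(separable_coinductionP _ _ _ (hflat D1) hJ)[chi1 bic1 chi1P].
  move=> /(separable_coinductionP _ _ _ (hflat D2) hJ)[chi2 bic2 chi2P].
  apply/(separable_coinductionP _ _ _ (hflat _) hJ).
  exists (chi1 ⊗[dcirc V] chi2); first exact: bicolinear_circ.
  by rewrite /= -!tmor_comp chi1P chi2P tmor_id.
- move=> /(naturally_full_coinductionP _ _ _ (hflat D1) hJ)[chi1 bic1 chi1P].
  move=> /(naturally_full_coinductionP _ _ _ (hflat D2) hJ)[chi2 bic2 chi2P].
  apply/(naturally_full_coinductionP _ _ _ (hflat _) hJ).
  exists (chi1 ⊗[dcirc V] chi2); first exact: bicolinear_circ.
  by rewrite /= -!tmor_comp chi1P chi2P tmor_id.
Qed.
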